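(* Let $d\in\mathbb{N}\cup\{0\}$ and $m\in\mathbb{N}$. Let $X$ be a compact metric space and $T:X\to X$ a homeomorphism. Assume that $\dim(X)=d$ and that $\dim(P_n)<mn/2$ for all $1\le n\le 2d$, where $P_n$ denotes the set of periodic points of $T$ of period $\le n$. Then the set of functions $h\in C(X,[0,1]^m)$ for which the map $$h_0^{2d}:X\to([0,1]^m)^{2d+1},\qquad x\mapsto\left(h(x),h(Tx),\dots,h(T^{2d}x)\right)$$ is an embedding is comeagre in $C(X,[0,1]^m)$ with respect to the topology of the supremum norm.
   Context: $\mathbb{N}=\{1,2,3,\dots\}$. $C(X,[0,1]^m)$ is the space of continuous functions $X\to[0,1]^m$ with the metric induced by $\|\cdot\|_\infty$. A subset of a topological space is comeagre (generic) if it is the complement of a countable union of nowhere dense sets. An embedding here is a continuous injective map (on the compact space $X$, equivalently a homeomorphism onto its image). $\dim$ is Lebesgue covering dimension: for a finite open cover $\alpha$ of a compact metric space $Z$, $\operatorname{ord}(\alpha)=-1+\max_{x\in Z}\#\{U\in\alpha: x\in U\}$, $D(\alpha)=\min_{\beta\succ\alpha}\operatorname{ord}(\beta)$, where $\beta\succ\alpha$ means that $\beta$ is a finite open cover of $Z$ such that every $V\in\beta$ is contained in some $U\in\alpha$; and $\dim(Z)=\sup_\alpha D(\alpha)$ over all finite open covers $\alpha$ of $Z$ (with the usual convention $\dim(\emptyset)=-1$). For $n\ge1$, $P_n=\{x\in X: T^i x=x\text{ for some }1\le i\le n\}$. *)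

(* Defs.v *)
From HB Require Import structures.
From mathcomp Require Import all_boot all_order all_algebra finmap.
From mathcomp Require Import all_classical all_reals all_analysis.

Set Implicit Arguments.
Unset Strict Implicit.
Unset Printing Implicit Defensive.

Import Order.TTheory GRing.Theory Num.Theory.
Import numFieldNormedType.Exports.

Local Open Scope classical_set_scope.
Local Open Scope ring_scope.

Section CoveringDimension.
Variable Z : topologicalType.
Implicit Types (alpha beta : {fset set Z}) (x : Z).

Definition open_cover alpha :=
  (forall U, U \in alpha -> open U) /\ \bigcup_(U in [set` alpha]) U = [set: Z].

Definition refines beta alpha :=
  open_cover beta /\ forall V, V \in beta -> exists2 U, U \in alpha & V `<=` U.

Definition multiplicity alpha x : nat := #|` [fset U in alpha | x \in U]|%fset.

(* The maximum is over the values taken by the multiplicity, which are at most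
   #|` alpha|; it is 0 if Z is empty, so that the order is then -1. *)
Definition cover_order alpha : int :=
  (\max_(k < (#|` alpha|).+1 | `[< exists x, multiplicity alpha x = k >]) k)%N%:Z
  - 1.

Variable R : realType.

(* The set of orders is nonempty (an open cover refines itself) and consists of
   integers at least -1, so this infimum is a minimum. *)
Definition min_order alpha : \bar R :=
  ereal_inf [set (cover_order beta)%:~R%:E | beta in [set b | refines b alpha]].

Definition covering_dim : \bar R :=
  ereal_sup [set min_order alpha | alpha in [set a | open_cover a]].

End CoveringDimension.

Arguments covering_dim Z R : clear implicits.

Section Category.
Variable S : topologicalType.
Implicit Type A : set S.

Definition nowhere_dense A := interior (closure A) = set0.

(* As set0 is nowhere dense, sequences also account for finite unions. *)
Definition comeagre A :=
  exists2 F : (set S)^nat, (forall i, nowhere_dense (F i)) & A = ~` \bigcup_i F i.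

End Category.

Definition homeomorphism (X Y : topologicalType) (f : X -> Y) :=
  continuous f /\
  exists g : Y -> X, [/\ cancel f g, cancel g f & continuous g].

(* The domains of interest are compact and the codomains Hausdorff, where this
   is the same as a homeomorphism onto the image. *)
Definition embedding (X Y : topologicalType) (f : X -> Y) :=
  continuous f /\ injective f.

Definition periodic_points (X : Type) (T : X -> X) (n : nat) : set X :=
  [set x | exists i : nat, (1 <= i <= n)%N /\ iter i T x = x].

Definition cube (R : realType) (m : nat) : set 'rV[R]_m :=
  [set v | forall j, 0 <= v ord0 j <= 1].
Arguments cube R m : clear implicits.

(* C(X, [0,1]^m), with the uniformity of uniform convergence on X; the one on
   [0,1]^m is induced by that of 'rV[R]_m, whose norm is the maximum norm. *)
Definition cube_maps (R : realType) (X : topologicalType) (m : nat) :=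
  continuousType X (cube R m).
Arguments cube_maps R X m : clear implicits.

Section CubeMapsUniform.
Import ArrowAsUniformType.
HB.instance Definition _ (R : realType) (X : topologicalType) (m : nat) :=
  Uniform.copy (cube_maps R X m)
    (initial_topology (id : continuousType X (cube R m) -> (X -> cube R m))).
End CubeMapsUniform.

Definition delay_map (R : realType) (X : topologicalType) (T : X -> X)
    (m : nat) (h : cube_maps R X m) (N : nat) (x : X) :
    {ptws 'I_N.+1 -> cube R m} :=
  fun i => (h : continuousType X (cube R m)) (iter i T x).
Arguments delay_map {R X} T {m} h N x.

(* Main.v *)
Require Import Defs.
From HB Require Import structures.
From mathcomp Require Import all_boot all_order all_algebra.
From mathcomp Require Import all_classical all_reals all_analysis.
From mathcomp Require Import finmap zify ring lra.

Set Implicit Arguments.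
Unset Strict Implicit.
Unset Printing Implicit Defensive.

Import Order.TTheory GRing.Theory Num.Theory.
Import numFieldNormedType.Exports.
Local Open Scope classical_set_scope.
Local Open Scope ring_scope.

(** The space X being compact, the delay map of h is an embedding exactly when it
    is injective. The pairs (x, y) with x <> y are covered by countably many
    compact pieces K, and for each of them the maps h for which some pair of K has
    equal delay vectors form a nowhere dense set. Separating all pairs of K is an
    open condition by compactness ([nowhere_dense_collisions]); that it is dense
    is a count of parameters against equations.

    Let p be the period of x, and A a small closed neighbourhood of x in the set of
    points of period at most p. The iterates T ^ i A for i < p are disjoint and
    T ^ p is the identity on A, so h may be altered independently on them; if p is
    large or infinite, A is a neighbourhood in X and enough iterates are disjoint.
    Replace h (T ^ i x) by an average of values v (i, V), weighted by a partition of
    unity psi V (x) on A whose supports meet at most a + 1 at a time, a being the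
    dimension of A ([perturbation]). A point of A then counts for a parameters, and
    the hypotheses give 2 a < m * min(p, 2 d + 1) for all p ([dim_le_level]).

    - If the delay segments of x and y are disjoint, and the periods, cut off at
      2 d + 1, are p <= q, then y visits q distinct points, none of them visited by
      x. This makes m * q independent equations against a + b < m * q parameters
      ([avoid_distinct_orbits]).
    - If y = T ^ k x, the only parameters are those of x. The equations
      h (T ^ i x) = h (T ^ (i + k) x) link visited points in a graph; min(p, 2 d + 1)
      vertices are not isolated, so at least half as many of the equations are
      independent, and m times this number exceeds a ([avoid_same_orbit]).

    When the parameters are fewer than the equations, generic values v leave no
    solution ([generic_values]). In place of a dimension theory for the set of bad
    values, the bad points of a fine grid are counted. *)

(** * Points in general position *)

(** Listing the at most K pairs (x, q x) with q x != z determines q; None pads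
    the list to length K. *)
Lemma card_sparse (T F : finType) (z : F) (K : nat) :
  (#|[set q : {ffun T -> F} | #|[set x | q x != z]%SET| <= K]%SET|
     <= (#|T| * #|F|).+1 ^ K)%N.
Proof.
pose dec (c : {ffun 'I_K -> option (T * F)}) : {ffun T -> F} :=
  [ffun x => odflt z [pick y | Some (x, y) \in codom c]].
rewrite -[X in (_ <= _ ^ X)%N]card_ord -card_prod -card_option -card_ffun.
rewrite -cardsT; apply: leq_trans (leq_imset_card dec _).
apply: subset_leq_card; apply/fintype.subsetP => q; rewrite inE => qK.
set s := [set x | q x != z]%SET in qK.
pose c : {ffun 'I_K -> option (T * F)} :=
  [ffun i : 'I_K => nth None [seq Some (x, q x) | x <- enum s] i].
apply/imsetP; exists c => //; apply/ffunP => x; rewrite ffunE.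
case: pickP => [y /codomP[i]|none] /=.
  rewrite ffunE; case: (ltnP i (size (enum s))) => [lti|lei].
    by rewrite (nth_map x) // => -[<- <-].
  by rewrite nth_default // size_map.
apply/eqP/negPn/negP => qx; have xs : x \in enum s by rewrite mem_enum inE.
have lti : (index x (enum s) < K)%N.
  by apply: leq_trans qK; rewrite cardE index_mem.
move: (none (q x)) => /negbT/negP; apply; apply/codomP; exists (Ordinal lti).
by rewrite ffunE /= (nth_map x) ?index_mem // nth_index.
Qed.

(** The counting form of an equation that determines the coordinates in P, up
    to E, from the others: reducing those coordinates modulo E.+1 loses nothing. *)
Lemma card_rigid (T : finType) (P : {set T}) (M E : nat)
    (G : {set {ffun T -> 'I_M}}) :
  (forall k k', k \in G -> k' \in G -> (forall x, x \notin P -> k x = k' x) ->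
     forall x, x \in P -> (k x <= k' x + E)%N) ->
  (#|G| <= M ^ (#|T| - #|P|) * E.+1 ^ #|P|)%N.
Proof.
move=> rig.
have red_lt (k : {ffun T -> 'I_M}) x : ((k x : nat) %% E.+1 < M)%N.
  exact: leq_ltn_trans (leq_mod _ _) (ltn_ord _).
pose red (k : {ffun T -> 'I_M}) : {ffun T -> 'I_M} :=
  [ffun x => if x \in P then Ordinal (red_lt k x) else k x].
have red_inj : {in G &, injective red}.
  move=> k k' Gk Gk' /ffunP eqr.
  have off x : x \notin P -> k x = k' x.
    by move=> xP; have := eqr x; rewrite !ffunE (negbTE xP).
  have off' x : x \notin P -> k' x = k x by move=> /off.
  apply/ffunP => x; have [xP|] := boolP (x \in P); last exact: off.
  have h1 := rig _ _ Gk Gk' off _ xP; have h2 := rig _ _ Gk' Gk off' _ xP.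
  have /(congr1 val) := eqr x; rewrite !ffunE xP /= => eqm.
  apply/val_inj => /=; move: h1 h2 eqm.
  move: (k x : nat) (k' x : nat) => u u' h1 h2 eqm.
  wlog leu : u u' h1 h2 eqm / (u <= u')%N.
    by move=> H; case: (leqP u u') => [|/ltnW] /H; [apply|move=> ->].
  have : (u' == u %[mod E.+1])%N by rewrite eqm.
  rewrite eqn_mod_dvd // => /dvdnP[c cE].
  by case: c cE => [|c]; nia.
rewrite -(card_in_imset red_inj).
pose fam (x : T) : {pred 'I_M} :=
  if x \in P then [pred y : 'I_M | (y < E.+1)%N] else predT.
apply: (@leq_trans #|family fam|).
  apply: subset_leq_card; apply/fintype.subsetP => _ /imsetP[k Gk ->].
  apply/familyP => x; rewrite ffunE /fam; case: ifP => // _.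
  by rewrite inE /= ltn_mod.
rewrite card_family foldrE big_image (bigID (mem P)) /= mulnC.
apply: leq_mul.
  apply: (@leq_trans (\prod_(x | x \notin P) M)).
    by apply: leq_prod => x xP; rewrite /fam (negbTE xP) cardT size_enum_ord.
  rewrite prod_nat_const; have -> // : #|[pred x | x \notin P]| = (#|T| - #|P|)%N.
  by rewrite -(cardC (mem P)) addKn; apply: eq_card.
rewrite -prod_nat_const; apply: leq_prod => x xP; rewrite /fam xP.
have f_lt (y : 'I_M) : (minn y E < E.+1)%N by rewrite ltnS geq_minr.
rewrite -[X in (_ <= X)%N]card_ord.
rewrite -(@card_in_imset _ _ (fun y : 'I_M => Ordinal (f_lt y))).
  exact: max_card.
move=> y y'; rewrite !inE !ltnS => yE y'E /(congr1 val) /=.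
by rewrite (minn_idPl yE) (minn_idPl y'E) => /val_inj.
Qed.

Definition barycentric (R : numDomainType) (B : finType) n (a : B -> nat)
    (s : B -> 'I_n -> R) :=
  forall i, [/\ forall V, 0 <= s i V, \sum_V s i V = 1
              & (#|[set V | s i V != 0%R]%SET| <= (a i).+1)%N].

(** Cells of side 1 / M for families of barycentric coordinates, named by the
    index c.1 i of a large coordinate and by the truncations of the others. The
    large one is left out since it is 1 minus the others: this is what makes the
    number of cells grow like M ^ (\sum_i a i), the dimension of a product of
    simplices of dimensions a i, and not with the number of nonzero coordinates. *)
Definition in_cell (R : archiRealFieldType) (B : finType) n M (s : B -> 'I_n -> R)
    (c : {ffun B -> 'I_n} * {ffun B * 'I_n -> 'I_M.+1}) :=
  forall i, 1 <= n%:R * s i (c.1 i) /\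
    forall V, c.2 (i, V) = (if V == c.1 i then 0 else Num.truncn (M%:R * s i V))%N :> nat.

Section Cells.
Variables (R : archiRealFieldType) (B : finType) (n : nat) (a : B -> nat).
Implicit Types s : B -> 'I_n -> R.

Lemma barycentric_le1 s : barycentric a s -> forall i V, s i V <= 1.
Proof.
move=> bs i V; have [s0 <- _] := bs i.
by rewrite (bigD1 V) //= lerDl sumr_ge0.
Qed.

Lemma in_cell_exists s M : barycentric a s ->
  exists2 c : {ffun B -> 'I_n} * {ffun B * 'I_n -> 'I_M.+1},
    in_cell s c & (#|[set x | c.2 x != ord0]%SET| <= \sum_i a i)%N.
Proof.
move=> bs.
(* n coordinates of sum 1 cannot all be smaller than 1 / n *)
have /fin_all_exists[V0 V0P] i : exists V, 1 <= n%:R * s i V.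
  apply: contrapT => /forallNP none; have [s0 s1 _] := bs i.
  have n0 : (0 < n)%N.
    case: (n) s s0 s1 {none bs} => // s _; rewrite big_ord0 => /eqP.
    by rewrite eq_sym oner_eq0.
  have : \sum_(V < n) n%:R * s i V < \sum_(V < n) 1.
    apply: ltr_sum => [|V _]; last by rewrite ltNge; apply/negP/none.
    by apply/hasP; exists (Ordinal n0); rewrite // mem_index_enum.
  by rewrite -mulr_sumr s1 mulr1 sumr_const card_ord ltxx.
pose q i V := (if V == V0 i then 0 else Num.truncn (M%:R * s i V))%N.
have q_lt x : (q x.1 x.2 < M.+1)%N.
  rewrite /q; case: ifP => // _; rewrite ltnS -(ler_nat R).
  have [s0 _ _] := bs x.1.
  apply: le_trans (_ : M%:R * s x.1 x.2 <= _).
    by have /andP[] := @truncn_itv R (M%:R * s x.1 x.2) (mulr_ge0 (ler0n _ _) (s0 _)).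
  by rewrite ler_piMr // barycentric_le1.
exists ([ffun i => V0 i], [ffun x => Ordinal (q_lt x)]) => [i|] /=.
  by rewrite ffunE; split => // V; rewrite ffunE.
rewrite -sum1_card (eq_bigl (fun x => q x.1 x.2 != 0%N)); last first.
  by move=> x; rewrite inE ffunE.
rewrite -(pair_big_dep xpredT (fun i V => q i V != 0%N) (fun _ _ => 1%N)) /=.
apply: leq_sum => i _; rewrite sum1_card -ltnS.
have [s0 s1 sa] := bs i; apply: leq_trans sa.
have V0in : V0 i \in [set V | s i V != 0%R]%SET.
  by rewrite inE; apply: contraTneq (V0P i) => ->; rewrite mulr0 ler10.
rewrite (cardsD1 (V0 i)) V0in ltnS; apply: subset_leq_card.
apply/fintype.subsetP => V; rewrite !inE unfold_in /q.
have [//|_ /= qV] := eqVneq V (V0 i).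
by apply: contraNneq qV => ->; rewrite mulr0 truncn0.
Qed.

Lemma in_cell_close s s' M c : (0 < M)%N -> barycentric a s -> barycentric a s' ->
  @in_cell R B n M s c -> in_cell s' c ->
  forall i V, `|s i V - s' i V| <= n%:R / M%:R.
Proof.
move=> M0 bs bs' cs cs' i V.
have M0' : 0 < M%:R :> R by rewrite ltr0n.
have [_ qs] := cs i; have [_ qs'] := cs' i.
have [s0 s1 _] := bs i; have [s0' s1' _] := bs' i.
have near W : W != c.1 i -> `|s i W - s' i W| <= M%:R^-1.
  move=> /negbTE WV.
  have := qs W; have := qs' W; rewrite !WV => -> eqt.
  have /andP[h1 h2] := @truncn_itv R (M%:R * s i W) (mulr_ge0 (ler0n _ _) (s0 _)).
  have /andP[h3 h4] := @truncn_itv R (M%:R * s' i W) (mulr_ge0 (ler0n _ _) (s0' _)).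
  rewrite -eqt -!natr1 in h1 h2 h4 h3.
  rewrite -[_^-1]mul1r ler_pdivlMr // -[X in _ * X]gtr0_norm // -normrM ler_norml.
  by apply/andP; split; nra.
have n1 : 1 <= n%:R :> R by rewrite ler1n (leq_ltn_trans _ (ltn_ord V)).
have [->|VV0] := eqVneq V (c.1 i); last first.
  apply: le_trans (near _ VV0) _; rewrite ler_peMl // invr_ge0 ltW //.
have -> : s i (c.1 i) - s' i (c.1 i) = \sum_(W | W != c.1 i) (s' i W - s i W).
  rewrite sumrB; move: s1 s1'; rewrite (bigD1 (c.1 i)) //= => h.
  rewrite (bigD1 (c.1 i)) //= => h'.
  move: h h'; move: (\sum_(_ | _) _) (\sum_(_ | _) _) => u u' h h'; lra.
apply: le_trans (ler_norm_sum _ _ _) _.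
apply: (@le_trans _ _ (\sum_(W < n) M%:R^-1)); last first.
  by rewrite sumr_const card_ord mulr_natl.
rewrite [leRHS](bigID (fun W => W != c.1 i)) /= -[leLHS]addr0.
apply: lerD; last by apply: sumr_ge0 => W _; rewrite invr_ge0 ltW.
by apply: ler_sum => W /near; rewrite distrC.
Qed.

End Cells.

(** The dimension count. Each b of S imposes one scalar equation on s, and s has
    \sum_i a i degrees of freedom, fewer than #|S|; so values v in general
    position admit no solution s.
    General position is reached by counting. Take v on the grid w + e k / M. If
    v is bad, pick a solution s of all the equations and its cell of side 1 / M.
    Within a cell, s is known up to O(1 / M) and has a coordinate at least 1 / n
    at c.1 (base b), so the equation of b determines the grid value at
    (b, c.1 (base b)) up to a constant E, from the other values: as mate b is
    outside S, those on its other side are not among the #|S| determined ones.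
    Hence a cell accounts for O(M ^ (#|N| * n - #|S|)) bad points, all cells for
    O(M ^ (#|N| * n - #|S| + \sum_i a i)), and the grid has M ^ (#|N| * n). *)
Lemma generic_values (R : archiRealFieldType) (B N : finType) (n : nat)
    (base : N -> B) (S : {set N}) (mate : N -> N) (a : B -> nat)
    (w : N -> 'I_n -> R) (e : R) :
  0 < e -> (forall b, b \in S -> mate b \notin S) -> (\sum_i a i < #|S|)%N ->
  exists2 v : N -> 'I_n -> R, forall b V, w b V <= v b V <= w b V + e &
    forall s, barycentric a s ->
      exists2 b, b \in S & \sum_V s (base b) V * v b V !=
                           \sum_V s (base (mate b)) V * v (mate b) V.
Proof.
move=> e0 mateS ltS; set K := (\sum_i a i)%N in ltS; set r := #|S| in ltS.
pose W := \sum_b \sum_V `|w b V| + e.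
have W0 : 0 <= W.
  by apply: addr_ge0; [apply: sumr_ge0 => b _; apply: sumr_ge0 | exact: ltW].
have leW b V : `|w b V| + e <= W.
  rewrite lerD2r (bigD1 b) //= (bigD1 V) //= -addrA lerDl addr_ge0 ?sumr_ge0 //.
  by move=> b' _; apply: sumr_ge0.
(* the spread of a determined grid value, from the bounds in key below *)
pose E := (Num.truncn (2 * n%:R ^+ 3 * W / e)).+1.
have ltE : 2 * n%:R ^+ 3 * W / e < E%:R.
  by rewrite /E; apply: truncnS_gt.
(* the constant in the count: M > C suffices *)
pose C := (n ^ #|B| * (2 * (#|B| * n)).+1 ^ K * E.+1 ^ r)%N.
pose M := C.+1.
have M0 : (0 : R) < M%:R by rewrite ltr0n.
pose v (k : {ffun N * 'I_n -> 'I_M}) b V := w b V + e * ((k (b, V) : nat)%:R / M%:R).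
have v_box k b V : w b V <= v k b V <= w b V + e.
  rewrite /v lerDl lerD2l mulr_ge0 ?divr_ge0 ?ler0n //=; last exact: ltW.
  by rewrite ler_piMr ?ltW // ltr_pdivrMr // mul1r ltr_nat.
have v_le k b V : `|v k b V| <= W.
  apply: le_trans (leW b V); have /andP[h1 h2] := v_box k b V.
  have := ler_norm (w b V); have := ler_norm (- w b V); rewrite normrN ler_norml.
  by move=> *; apply/andP; split; lra.
apply: contrapT => nov.
have bad k : exists s, barycentric a s /\ forall b, b \in S ->
    \sum_V s (base b) V * v k b V =
    \sum_V s (base (mate b)) V * v k (mate b) V.
  apply: contrapT => nos; apply: nov; exists (v k) => // s bs.
  apply: contrapT => nob; apply: nos; exists s; split => // b bS.
  by apply/eqP/negPn/negP => h; apply: nob; exists b.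
have /fin_all_exists[s /all_and2[bs sv]] := bad.
have cell k := @in_cell_exists R B n a (s k) M (bs k).
have /fin_all_exists2[c cs cK] := cell.
pose Q := finset.setX [set: {ffun B -> 'I_n}]%SET
  [set q : {ffun B * 'I_n -> 'I_M.+1} | #|[set x | q x != ord0]%SET| <= K]%N%SET.
have cQ k : c k \in Q by rewrite !inE cK.
pose G d := [set k | c k == d]%SET.
have cardG d : (#|G d| <= M ^ (#|N| * n - r) * E.+1 ^ r)%N.
  pose P := [set (b, d.1 (base b)) | b in S]%SET.
  have cardP : #|P| = r by rewrite card_imset // => b b' [].
  rewrite -cardP -[X in (_ * X - _)%N]card_ord -card_prod.
  apply: card_rigid => k k'; rewrite !inE => /eqP ck /eqP ck' off x.
  case/imsetP => b bS ->{x}.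
  have csk : in_cell (s k) d by rewrite -ck.
  have csk' : in_cell (s k') d by rewrite -ck'.
  have close := in_cell_close (ltn0Sn C) (bs k) (bs k') csk csk'.
  have [piv _] := csk (base b).
  have n0 : (0 < n)%N by apply: leq_ltn_trans (ltn_ord (d.1 (base b))).
  have nR : (1 : R) <= n%:R by rewrite ler1n.
  have vm V : v k (mate b) V = v k' (mate b) V.
    rewrite /v off //; apply/negP => /imsetP[b' b'S [mb _]].
    by move: (mateS _ bS); rewrite mb b'S.
  have vo V : V != d.1 (base b) -> v k b V = v k' b V.
    move=> Vd; rewrite /v off //; apply/negP => /imsetP[b' b'S [bb' VV]].
    by move: Vd; rewrite VV bb' eqxx.
  (* subtracting the equations of b for k and k' isolates the pivot *)
  have key : s k (base b) (d.1 (base b)) *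
      (v k b (d.1 (base b)) - v k' b (d.1 (base b))) =
      \sum_V (s k (base (mate b)) V - s k' (base (mate b)) V) * v k' (mate b) V -
      \sum_V (s k (base b) V - s k' (base b) V) * v k' b V.
    have := sv k b bS; have := sv k' b bS.
    have -> : \sum_V s k (base (mate b)) V * v k (mate b) V =
              \sum_V s k (base (mate b)) V * v k' (mate b) V.
      by apply: eq_bigr => V _; rewrite vm.
    have -> : \sum_V s k (base b) V * v k b V =
        s k (base b) (d.1 (base b)) * v k b (d.1 (base b)) +
        \sum_(V | V != d.1 (base b)) s k (base b) V * v k' b V.
      rewrite (bigD1 (d.1 (base b))) //=; congr (_ + _).
      by apply: eq_bigr => V /vo ->.
    have dec : \sum_V s k (base b) V * v k' b V =
        s k (base b) (d.1 (base b)) * v k' b (d.1 (base b)) +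
        \sum_(V | V != d.1 (base b)) s k (base b) V * v k' b V.
      by rewrite (bigD1 (d.1 (base b))).
    under [X in _ -> _ -> _ = X - _]eq_bigr do rewrite mulrBl.
    under [X in _ -> _ -> _ = _ - X]eq_bigr do rewrite mulrBl.
    rewrite !sumrB => e1 e2.
    move: e1 e2 dec; rewrite mulrBr; lra.
  have bnd b' : `|\sum_V (s k (base b') V - s k' (base b') V) * v k' b' V| <=
      n%:R * (n%:R / M%:R * W).
    apply: le_trans (ler_norm_sum _ _ _) _.
    apply: (@le_trans _ _ (\sum_(V < n) n%:R / M%:R * W)).
      by apply: ler_sum => V _; rewrite normrM ler_pM.
    by rewrite sumr_const card_ord -[leLHS]mulr_natl.
  have {}key : `|v k b (d.1 (base b)) - v k' b (d.1 (base b))| <= 2 * n%:R ^+ 3 * W / M%:R.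
    have := congr1 Num.norm key; rewrite normrM => key'.
    have : s k (base b) (d.1 (base b)) *
        `|v k b (d.1 (base b)) - v k' b (d.1 (base b))| <= 2 * (n%:R * (n%:R / M%:R * W)).
      have s0 : 0 <= s k (base b) (d.1 (base b)) by have [+ _ _] := bs k (base b).
      rewrite -[X in X * _](ger0_norm s0) key' (le_trans (ler_normB _ _)) //.
      by rewrite mulrDl !mul1r lerD.
    move: piv; move: (s k _ _) (`|_|) (normr_ge0 (v k b (d.1 (base b)) - v k' b (d.1 (base b)))).
    move=> p y y0 p1 yp.
    apply: le_trans (_ : n%:R * p * y <= _); first by rewrite ler_peMl.
    rewrite -mulrA.
    apply: le_trans (_ : n%:R * (2 * (n%:R * (n%:R / M%:R * W))) <= _).
      by rewrite ler_wpM2l // ler0n.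
    by rewrite le_eqVlt; apply/orP; left; apply/eqP; field; rewrite gt_eqF.
  have diff : v k b (d.1 (base b)) - v k' b (d.1 (base b)) =
     e * (((k (b, d.1 (base b)) : nat)%:R - (k' (b, d.1 (base b)) : nat)%:R) / M%:R).
    by rewrite /v mulrBl mulrBr opprD addrACA subrr add0r.
  have : ((k (b, d.1 (base b)) : nat)%:R - (k' (b, d.1 (base b)) : nat)%:R : R) <= E%:R.
    apply: le_trans (ler_norm _) _; apply: ltW; apply: le_lt_trans ltE.
    rewrite ler_pdivlMr // mulrC.
    have Mi : `|M%:R^-1 : R| = M%:R^-1 by rewrite ger0_norm // invr_ge0 ltW.
    move: key; rewrite diff !normrM Mi (gtr0_norm e0) mulrA.
    by rewrite ler_pM2r // invr_gt0.
  by rewrite lerBlDr -natrD ler_nat addnC.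
have cardQ : (#|Q| <= n ^ #|B| * ((2 * (#|B| * n)).+1 * M) ^ K)%N.
  rewrite cardsX cardsT card_ffun card_ord leq_mul2l; apply/orP; right.
  have H := @card_sparse (B * 'I_n)%type 'I_M.+1 ord0 K. apply: leq_trans H _; rewrite card_prod !card_ord.
  have [->|K0] := posnP K; first by rewrite !expn0.
  by rewrite leq_exp2r //; nia.
have : (M ^ (#|N| * n) <= #|Q| * (M ^ (#|N| * n - r) * E.+1 ^ r))%N.
  have -> : (M ^ (#|N| * n))%N = #|{ffun N * 'I_n -> 'I_M}|.
    by rewrite card_ffun card_prod !card_ord.
  rewrite -[leqLHS]cardsT -[leqLHS]sum1_card (partition_big c (mem Q)) /=; last by move=> *; exact: cQ.
  rewrite -[leqRHS]sum_nat_const; apply: leq_sum => d _; apply: leq_trans (cardG d).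
  by rewrite -sum1_card leq_eqVlt; apply/orP; left; apply/eqP/eq_bigl => k; rewrite !inE.
have leS : (r <= #|N| * n)%N.
  have n0 : (0 < n)%N.
    have /card_gt0P[b bS] : (0 < #|S|)%N by apply: leq_ltn_trans ltS.
    exact: leq_ltn_trans (ltn_ord ((c [ffun => ord0]).1 (base b))).
  by apply: leq_trans (max_card _) _; rewrite leq_pmulr.
apply/negP; rewrite -ltnNge.
apply: (@leq_ltn_trans (C * M ^ K * M ^ (#|N| * n - r))).
  rewrite mulnCA mulnC leq_mul2r; apply/orP; right.
  apply: leq_trans (leq_mul cardQ (leqnn _)) _.
  by rewrite expnMn /C; apply: eq_leq; ring.
rewrite -[in ltnRHS](subnKC leS) expnD ltn_mul2r expn_gt0 /=.
apply: leq_trans (_ : (M ^ K.+1 <= _)%N); last by rewrite leq_pexp2l.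
by rewrite expnS ltn_mul2r expn_gt0 /= ltnSn.
Qed.

(** * Large sets of independent edges *)

(** In a graph, a maximal independent set D dominates: each vertex of V outside D
    has a neighbour in D, and each vertex of D has its neighbours outside D. So
    both D and V :\: D have the required property, and the larger one is big
    enough. *)
Lemma half_matching (T : finType) (e : rel T) (V : {set T}) :
  symmetric e -> irreflexive e -> (forall x, x \in V -> exists y, e x y) ->
  exists S : {set T}, [/\ S \subset V, (#|V| <= 2 * #|S|)%N &
    forall x, x \in S -> exists2 y, e x y & y \notin S].
Proof.
move=> symE irrE nb.
pose indep (D : {set T}) := (D \subset V) && [forall x in D, forall y in D, ~~ e x y].
have indep0 : indep finset.set0.
  by rewrite /indep finset.sub0set; apply/forall_inP => x; rewrite inE.
have [D /maxsetP[/andP[DV /forall_inP indD] maxD] _] := maxset_exists indep0.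
have DVcard : (#|D| + #|V :\: D| = #|V|)%N.
  by rewrite -(cardsID D V) (finset.setIidPr DV).
have [leD|ltD] := leqP #|V| (2 * #|D|).
  exists D; split => // x Dx; have [y exy] := nb x (fintype.subsetP DV _ Dx).
  exists y => //; apply/negP => Dy; have /forall_inP/(_ y Dy) := indD x Dx.
  by rewrite exy.
exists (V :\: D); split; [exact: finset.subsetDl | lia |].
move=> x; rewrite inE => /andP[xD xV].
have [/exists_inP[y Dy exy]|/exists_inPn none] := boolP [exists y in D, e x y].
  by exists y => //; rewrite inE Dy.
case/negP: xD; rewrite -(maxD (x |: D)) ?finset.subsetU1 // ?finset.setU11 //.
rewrite /indep finset.subUset finset.sub1set xV DV /=; apply/forall_inP => u; rewrite !inE => uP.
apply/forall_inP => z; rewrite !inE => zP.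
case/orP: uP => [/eqP->|Du]; case/orP: zP => [/eqP->|Dz].
- by rewrite irrE.
- exact: none.
- by rewrite symE none.
- by have /forall_inP/(_ z Dz) := indD u Du.
Qed.

(** * Partitions of unity from the covering dimension *)

Lemma distance_function (R : realType) (X : metricType R) (C : set X) : closed C ->
  exists f : X -> R,
    [/\ continuous f, forall x, 0 <= f x & forall x, f x = 0 <-> C x].
Proof.
move=> Ccl; have [[c0 Cc0]|C0] := pselect (C !=set0); last first.
  exists (fun=> 1); split => // [|x]; first exact: cst_continuous.
  by split => [/eqP|Cx]; [rewrite oner_eq0 | case: C0; exists x].
pose A x := [set mdist x c | c in C].
have Alb x : lbound (A x) 0 by move=> _ [c _ <-]; exact: mdist_ge0.
have A0 x : A x !=set0 by exists (mdist x c0), c0.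
have tri x y : inf (A x) <= mdist x y + inf (A y).
  rewrite -lerBlDl; apply: lb_le_inf => // _ [c Cc <-]; rewrite lerBlDl.
  apply: le_trans (metric_triangle _ _ _).
  by apply: ge_inf; [exists 0 | exists c].
exists (fun x => inf (A x)); split => [x|x|x].
- apply/(@cvgrPdist_lt _ R^o) => e e0; near=> y.
  have xye : mdist x y < e.
    have : ball x e y by near: y; exact: nbhsx_ballx.
    by rewrite ballEmdist.
  have := tri x y; have := tri y x; rewrite metric_sym => h1 h2.
  by apply: le_lt_trans xye; rewrite ler_norml; apply/andP; split; lra.
- exact: lb_le_inf.
- split => [A0x|Cx].
    apply: Ccl => U /nbhs_ballP[e /= e0 eU].
    have [_ [c Cc <-] ce] : exists2 d, A x d & d < e.
      by apply: inf_lt => //; rewrite A0x.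
    by exists c; split => //; apply: eU; rewrite ballEmdist.
  apply/eqP; rewrite eq_le lb_le_inf // andbT.
  by apply: ge_inf; [exists 0 | exists x => //; exact: mdistxx].
Unshelve. all: by end_near. Qed.

(** Compactness as a near-covering property, applied to the filter of all finite
    lists ordered by inclusion; the space may be empty. *)
Lemma compact_subcover (X : topologicalType) (K : set X) (U : X -> set X) :
  compact K -> (forall x, nbhs x (U x)) ->
  exists s : seq X, forall y, K y -> exists2 x, x \in s & U x y.
Proof.
move=> /compact_near_coveringP cov Unbhs.
pose F : set_system (seq X) :=
  [set A : set (seq X) | exists s0 : seq X, forall s : seq X, {subset s0 <= s} -> A s].
have FF : Filter F.
  split; first by exists [::].
    move=> A B [s sA] [t tB]; exists (s ++ t) => u stu; split.
      by apply: sA => x xs; apply: stu; rewrite mem_cat xs.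
    by apply: tB => x xs; apply: stu; rewrite mem_cat xs orbT.
  by move=> A B AB [s sA]; exists s => t /sA /AB.
have [|s] := cov (seq X) F (fun (s : seq X) y => exists2 x, x \in s & U x y) FF.
  move=> y Ky; exists (U y, [set s : seq X | y \in s]) => /=.
    split; first exact: Unbhs.
    by exists [:: y] => s; apply; rewrite inE.
  by move=> [z s] /= [Uyz ys]; exists y.
by move=> /(_ s (fun=> id)) sP; exists s => y /sP.
Qed.

Lemma continuous_sum (R : realType) (X : topologicalType) (n : nat) (f : 'I_n -> X -> R) :
  (forall i, continuous (f i)) -> continuous (fun x => \sum_(i < n) f i x).
Proof.
by move=> fc; apply: continuous_big => [|i _]; [exact: add_continuous | exact: fc].
Qed.

(** Dimension at most a, in the form used to approximate maps: partitions of unity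
    on P, subordinate to a given cover of X, sending P to the a-skeleton of a
    simplex. The functions are defined on the whole of X and numbered by nat, so
    that several such families can be extended by 0 to a common length. *)
Definition dim_le (R : realType) (X : metricType R) (P : set X) (a : nat) :=
  forall U : X -> set X, (forall x, open (U x) /\ U x x) ->
  exists n (psi : nat -> X -> R) (c : nat -> X),
    [/\ forall V, continuous (psi V), forall V x, 0 <= psi V x,
        forall V x, (n <= V)%N -> psi V x = 0,
        forall x, P x -> \sum_(V < n) psi V x = 1 &
        forall x, P x -> (forall V, psi V x != 0 -> U (c V) x) /\
          (#|[set V : 'I_n | psi V x != 0%R]%SET| <= a.+1)%N].

Lemma dim_leS (R : realType) (X : metricType R) (P Q : set X) a :
  P `<=` Q -> dim_le Q a -> dim_le P a.
Proof.
move=> PQ dQ U /dQ[n [psi [c [h1 h2 h3 h4 h5]]]].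
by exists n, psi, c; split => // x Px; [exact/h4/PQ | exact/h5/PQ].
Qed.

Lemma multiplicity_le_order (Z : topologicalType) (beta : {fset set Z}) z :
  ((multiplicity beta z)%:Z <= cover_order beta + 1).
Proof.
rewrite /cover_order subrK lez_nat.
have lt : (multiplicity beta z < (#|` beta|).+1)%N.
  by rewrite ltnS /multiplicity fsubset_leq_card // fset_sub.
apply: (@leq_bigmax_cond _ _ _ (Ordinal lt)) => /=.
by apply/asboolP; exists z.
Qed.

Lemma covering_dim_refine (R : realType) (Z : topologicalType) (q : R)
    (alpha : {fset set Z}) :
  (covering_dim Z R < q%:E)%E -> open_cover alpha ->
  exists2 beta, refines beta alpha & (cover_order beta)%:~R < q.
Proof.
move=> dimq oa; have : (min_order R alpha < q%:E)%E.
  by apply: le_lt_trans dimq; apply: ereal_sup_ubound; exists alpha.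
by move=> /ereal_inf_lt[_ [beta rb <-]]; rewrite lte_fin; exists beta.
Qed.

(** If beta refines the trace of the cover on the subspace, the distances to the
    complements of its members form, once divided by their sum, a partition of
    unity. Adding to the sum the distance to the subspace makes the quotients
    continuous on X without changing them on the subspace. *)
Lemma dim_le_covering (R : realType) (X : metricType R) (Z : topologicalType)
    (i : Z -> X) (q : R) (a : nat) (x0 : X) :
  continuous i ->
  (forall V, open V -> exists2 O, open O & V = i @^-1` O) ->
  compact [set: X] -> closed (range i) ->
  (covering_dim Z R < q%:E)%E -> (forall k : int, k%:~R < q -> k <= a) ->
  dim_le (range i) a.
Proof.
move=> ic ind compX clP dimq qa U oU.
have [s sP] : exists s : seq X, forall y, setT y -> exists2 x, x \in s & U x y.
  by apply: compact_subcover => // x; have [? ?] := oU x; exact: open_nbhs_nbhs.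
pose alpha : {fset set Z} := [fset V in [seq i @^-1` (U x) | x <- s]]%fset.
have oalpha : open_cover alpha.
  split=> [V|].
    rewrite !inE => /mapP[x _ ->]; apply: open_comp => [y _|]; first exact: ic.
    by have [] := oU x.
  apply/seteqP; split=> // z _; have [x xs Uxz] := sP (i z) I.
  by exists (i @^-1` (U x)) => //=; rewrite !inE; apply/mapP; exists x.
have [beta [[ob cb] rb] orb] := covering_dim_refine dimq oalpha.
pose n := #|` beta|.
pose Vf k := nth set0 (enum_fset beta) k.
have Vin k : (k < n)%N -> Vf k \in beta by move=> kn; rewrite /Vf mem_nth.
have exO k : exists O, open O /\ ((k < n)%N -> Vf k = i @^-1` O).
  have [kn|_] := boolP (k < n)%N; last by exists setT; split => //; exact: openT.
  by have [W oW VW] := ind _ (ob _ (Vin _ kn)); exists W.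
have /choice[ O /all_and2[oO VO]] := exO.
have cE k : exists c, (k < n)%N -> Vf k `<=` i @^-1` (U c).
  have [kn|_] := boolP (k < n)%N; last by exists x0.
  have [V + VV] := rb _ (Vin _ kn).
  by rewrite !inE => /mapP[c _ Vc]; exists c => _; rewrite -Vc.
have /choice[c cP] := cE.
(* the complement, in the subspace, of the k-th member of beta *)
have clC k : closed (range i `&` ~` O k).
  by apply: closedI => //; apply: open_closedC.
have /choice[phi /all_and3[phic phi0 phiP]] := fun k => distance_function (clC k).
have [dP [dPc dP0 dPP]] := distance_function clP.
pose D x := \sum_(k < n) phi k x + dP x.
have phiV k z : (k < n)%N -> phi k (i z) != 0 <-> Vf k z.
  move=> kn; rewrite (VO _ kn); split.
    by move=> /eqP pz; apply: contrapT => nO; apply/pz/phiP; split => //; exists z.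
  by move=> Oz; apply/eqP => /phiP[].
have D0 x : 0 < D x.
  have S0 : 0 <= \sum_(k < n) phi k x by apply: sumr_ge0.
  have [[z _ zx]|nP] := pselect (range i x); last first.
    by rewrite ltr_wpDl // lt0r dP0 andbT; apply/eqP => /dPP.
  rewrite ltr_wpDr //.
  have [V /= Vb Vz] : (\bigcup_(V in [set` beta]) V) z by rewrite cb.
  have Vlt : (index V (enum_fset beta) < n)%N by rewrite index_mem.
  have : phi (index V (enum_fset beta)) x != 0.
    by rewrite -zx; apply/phiV => //; rewrite /Vf nth_index.
  rewrite (bigD1 (Ordinal Vlt)) //= => pn0.
  by rewrite ltr_wpDr ?sumr_ge0 // lt0r pn0 phi0.
exists n, (fun k x => if (k < n)%N then phi k x / D x else 0), c; split.
- move=> k /=; case: (k < n)%N; last exact: cst_continuous.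
  move=> x; apply: cvgM; first exact: phic.
  apply: cvgV; first by rewrite gt_eqF.
  apply: cvgD; last exact: dPc.
  exact: continuous_sum.
- by move=> k x; case: ifP => // _; rewrite divr_ge0 ?phi0 // ltW.
- by move=> k x; rewrite leqNgt => /negbTE ->.
- move=> x Px; rewrite (eq_bigr (fun k : 'I_n => phi k x / D x)) => [|k _].
    have Dx : D x = \sum_(k < n) phi k x by rewrite /D; have /dPP -> := Px; rewrite addr0.
    by rewrite -mulr_suml -Dx divff // gt_eqF.
  by rewrite ltn_ord.
- move=> _ [z _ <-].
  have nz k : (if (k < n)%N then phi k (i z) / D (i z) else 0) != 0 ->
      (k < n)%N /\ Vf k z.
    case: ifP => [kn|]; last by rewrite eqxx.
    by rewrite mulf_eq0 negb_or => /andP[/phiV] /(_ kn).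
  split=> [k /nz[kn /(cP _ kn)]//|].
  apply: (@leq_trans (multiplicity beta z)); last first.
    have := multiplicity_le_order beta z.
    have := qa _ orb; rewrite -lez_nat => h1 h2.
    by apply: le_trans h2 _; rewrite -[a.+1]addn1 PoszD lerD2r.
  rewrite cardE /multiplicity -(size_map (fun k : 'I_n => Vf k)).
  apply: uniq_leq_size.
    rewrite map_inj_in_uniq ?enum_uniq // => j k _ _ /eqP.
    by rewrite nth_uniq ?ltn_ord ?fset_uniq // => /eqP /val_inj.
  move=> _ /mapP[k + ->]; rewrite mem_enum inE => /nz[kn Vz].
  by rewrite !inE Vin //=; apply/mem_set.
Qed.

(** * Perturbing a map into the cube *)

Lemma weighted_mean_bounds (R : numDomainType) n (s v : 'I_n -> R) (lo hi : R) :
  (forall V, 0 <= s V) -> \sum_V s V = 1 ->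
  (forall V, s V != 0 -> lo <= v V <= hi) ->
  lo <= \sum_V s V * v V <= hi.
Proof.
move=> s0 s1 vb; rewrite -[lo]mul1r -[hi]mul1r -s1 !mulr_suml.
apply/andP; split; apply: ler_sum => V _.
  have [->|/vb/andP[lov _]] := eqVneq (s V) 0; first by rewrite !mul0r.
  exact: ler_wpM2l.
have [->|/vb/andP[_ vhi]] := eqVneq (s V) 0; first by rewrite !mul0r.
exact: ler_wpM2l.
Qed.

Lemma finite_support_widen (R : nmodType) (f : nat -> R) n n' : (n <= n')%N ->
  (forall V, (n <= V)%N -> f V = 0) ->
  \sum_(V < n') f V = \sum_(V < n) f V /\
  (#|[set V : 'I_n' | f V != 0%R]%SET| <= #|[set V : 'I_n | f V != 0%R]%SET|)%N.
Proof.
move=> le f0; split.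
  rewrite [RHS](big_ord_widen _ f le) [RHS]big_mkcond /=; apply: eq_bigr => V _.
  by case: ltnP => // /f0.
apply: leq_trans (leq_imset_card (widen_ord le) _).
apply: subset_leq_card; apply/fintype.subsetP => V; rewrite inE => fV.
have Vn : (V < n)%N by rewrite ltnNge; apply: contra_neqN fV => /f0.
by apply/imsetP; exists (Ordinal Vn); [rewrite inE | exact: val_inj].
Qed.

(** The quotient of the distance to the other sets by the sum of the distances
    to them and to the given one. *)
Lemma separating_bumps (R : realType) (X : metricType R) (N : finType)
    (C : N -> set X) :
  (forall b, closed (C b)) -> (forall b b' x, C b x -> C b' x -> b = b') ->
  exists chi : N -> X -> R, (forall b, continuous (chi b)) /\
    forall b x, C b x -> forall b', chi b' x = (b' == b)%:R.
Proof.
move=> clC disC.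
pose D b := \bigcup_(b' in [set b' | b' != b]) C b'.
have clD b : closed (D b) by apply: closed_bigcup => [|? _]; [exact: finite_finset | exact: clC].
have /choice[g /all_and3[gc g0 gP]] := fun b => distance_function (clC b).
have /choice[k /all_and3[kc k0 kP]] := fun b => distance_function (clD b).
exists (fun b x => k b x / (k b x + g b x)); split=> [b x|b x Cx b'].
  apply: cvgM; first exact: kc.
  apply: cvgV; last by apply: cvgD; [exact: kc | exact: gc].
  apply/eqP => kg0; have k0' : k b x = 0 by have := k0 b x; have := g0 b x; lra.
  have g0' : g b x = 0 by have := k0 b x; have := g0 b x; lra.
  have /kP[b' /= b'b Cb'] := k0'; have /gP Cb := g0'.
  by move: b'b; rewrite (disC _ _ _ Cb' Cb) eqxx.
have [->|b'b] := eqVneq b' b.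
  have /gP -> := Cx; rewrite addr0 divff //; apply/eqP => /kP[b'' /= + Cb''].
  by rewrite (disC _ _ _ Cb'' Cx) eqxx.
have -> : k b' x = 0 by apply/kP; exists b => //=; rewrite eq_sym.
by rewrite mul0r.
Qed.

(** Nodes b stand for the pairwise disjoint sets tau b (A (base b)). On them f is
    replaced by an average of values v (b, l) with the weights of a fine partition
    of unity on A (base b). This stays close to f, and an unwanted coincidence
    along S becomes a system of #|S| * m equations in the barycentric coordinates
    of the points z i, to which generic_values applies. *)
Lemma perturbation (R : realType) (X : metricType R) (x0 : X)
    (B N : finType) (base : N -> B) (S : {set N}) (mate : N -> N) (a : B -> nat)
    (A : B -> set X) (tau tau' : N -> X -> X) (m : nat) (f : 'I_m -> X -> R) (e : R) :
  (forall b, continuous (tau b)) -> (forall b, continuous (tau' b)) ->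
  (forall b, cancel (tau b) (tau' b)) -> (forall b, cancel (tau' b) (tau b)) ->
  (forall i, closed (A i)) -> (forall i, dim_le (A i) (a i)) ->
  (forall b b' x x', A (base b) x -> A (base b') x' -> tau b x = tau b' x' -> b = b') ->
  (forall b, b \in S -> mate b \notin S) -> (\sum_i a i < m * #|S|)%N ->
  (forall l, continuous (f l)) -> (forall l x, 0 <= f l x <= 1) -> 0 < e ->
  exists h : 'I_m -> X -> R,
    [/\ forall l, continuous (h l), forall l x, 0 <= h l x <= 1,
        forall l x, `|h l x - f l x| <= e &
        forall z, (forall i, A i (z i)) -> exists2 b, b \in S & exists l,
          h l (tau b (z (base b))) != h l (tau (mate b) (z (base (mate b))))].
Proof.
move=> tauc tauc' tauK tauK' clA dimA disA mateS sumS fc f01 e0.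
pose e' := Num.min (e / 2) 1.
have e'0 : 0 < e' by rewrite lt_min ltr01 divr_gt0.
have e'1 : e' <= 1 by rewrite ge_min lexx orbT.
have e'e : e' + e' <= e by have : e' <= e / 2 by [rewrite ge_min lexx]; lra.
pose U c := interior [set x | forall p : N * 'I_m,
  `|f p.2 (tau p.1 c) - f p.2 (tau p.1 x)| < e'].
have UP c : open (U c) /\ U c c.
  split; first exact: open_interior.
  apply: filter_forall => -[b l] /=.
  have : {for c, continuous (f l \o tau b)}.
    by apply: continuous_comp; [exact: tauc | exact: fc].
  by move=> /(@cvgrPdist_lt _ R^o) /(_ _ e'0).
have /fin_all_exists[n0 /fin_all_exists[psi /fin_all_exists[c cP]]] :=
  fun i => dimA i U UP.
pose n := \max_i n0 i.
have nle i : (n0 i <= n)%N by exact: leq_bigmax.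
have bary z : (forall i, A i (z i)) ->
    barycentric a (fun i (V : 'I_n) => psi i V (z i)).
  move=> Az i; have [_ p0 pn p1 pa] := cP i.
  have [sumE cardle] := @finite_support_widen R (fun V => psi i V (z i)) _ _ (nle i)
    (fun V => pn V (z i)).
  split => [V||]; first exact: p0.
    by rewrite sumE p1.
  by apply: leq_trans cardle _; have [] := pa _ (Az i).
pose base' (p : N * 'I_m) := base p.1.
pose mate' (p : N * 'I_m) := (mate p.1, p.2).
pose S' := finset.setX S [set: 'I_m]%SET.
(* the factor 1 - e' leaves room for a move of e' inside [0, 1] *)
pose w (p : N * 'I_m) (V : 'I_n) := (1 - e') * f p.2 (tau p.1 (c (base p.1) V)).
have mateS' p : p \in S' -> mate' p \notin S'.
  by rewrite !inE !andbT => /mateS.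
have sumS' : (\sum_i a i < #|S'|)%N by rewrite cardsX cardsT card_ord mulnC.
have [v vw vP] := @generic_values R B _ n base' S' mate' a w e' e'0 mateS' sumS'.
pose C b := tau' b @^-1` A (base b).
have clC b : closed (C b) by apply: closed_comp => // x _; exact: tauc'.
have disC b b' x : C b x -> C b' x -> b = b'.
  by move=> Cb Cb'; apply: disA Cb Cb' _; rewrite !tauK'.
have [chi [chic chiP]] := separating_bumps clC disC.
pose g l x := \sum_b chi b x * \sum_(V < n) psi (base b) V (tau' b x) * v (b, l) V.
have gc l : continuous (g l).
  apply: continuous_big => [|b _]; first exact: add_continuous.
  move=> x; apply: cvgM; first exact: chic.
  apply: continuous_sum => V y; apply: cvgMr_tmp.
  apply: (@continuous_comp _ _ _ (tau' b)); first exact: tauc'.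
  by have [pc _ _ _ _] := cP (base b); exact: pc.
have gE l b z : A (base b) z ->
    g l (tau b z) = \sum_(V < n) psi (base b) V z * v (b, l) V.
  move=> Az; have Cb : C b (tau b z) by rewrite /C /= tauK.
  rewrite /g (bigD1 b) //= (chiP _ _ Cb) eqxx mul1r tauK [X in _ + X = _]big1 ?addr0 // => b' b'b.
  by rewrite (chiP _ _ Cb) (negbTE b'b) mul0r.
have gbnd l b z : A (base b) z ->
    0 <= g l (tau b z) <= 1 /\ `|g l (tau b z) - f l (tau b z)| <= e.
  move=> Az; rewrite gE //.
  have [_ p0 pn p1 pa] := cP (base b).
  have [sumE _] := @finite_support_widen R (fun V => psi (base b) V z) _ _ (nle _)
    (fun V => pn V z).
  have s1 : \sum_(V < n) psi (base b) V z = 1 by rewrite sumE p1.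
  have [near _] := pa _ Az.
  split.
    apply: weighted_mean_bounds => // V _.
    have := vw (b, l) V; rewrite /w /= => /andP[h1 h2].
    have /andP[f0 f1] := f01 l (tau b (c (base b) V)).
    by apply/andP; split; nra.
  rewrite ler_distl; apply: weighted_mean_bounds => // V /near /interior_subset.
  move=> /(_ (b, l)) /=; rewrite ltr_norml => /andP[h3 h4].
  have := vw (b, l) V; rewrite /w /= => /andP[h1 h2].
  have /andP[f0 f1] := f01 l (tau b (c (base b) V)).
  by apply/andP; split; nra.
(* truncation forces closeness to f off the node sets, and changes nothing there *)
pose h l x := Num.max (Num.max 0 (f l x - e)) (Num.min (Num.min 1 (f l x + e)) (g l x)).
have hE l b z : A (base b) z -> h l (tau b z) = g l (tau b z).
  move=> /(gbnd l)[/andP[g0 g1]]; rewrite ler_distl => /andP[g2 g3].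
  rewrite /h min_r; last by rewrite le_min g1 g3.
  by rewrite max_r // ge_max g0 g2.
exists h; split => [l x|l x|l x|z Az].
- have lo_c : continuous (fun x => f l x - e : R^o).
    by move=> y; apply: cvgB; [exact: fc | exact: cvg_cst].
  have hi_c : continuous (fun x => f l x + e : R^o).
    by move=> y; apply: cvgD; [exact: fc | exact: cvg_cst].
  have := continuous_max (continuous_max (@cst_continuous _ R^o 0 x) (lo_c x))
    (continuous_min (continuous_min (@cst_continuous _ R^o 1 x) (hi_c x)) (gc l x)).
  exact.
- have /andP[f0 f1] := f01 l x; apply/andP; split; rewrite /h.
    by rewrite !le_max lexx.
  by rewrite !ge_max !ge_min lexx ler01 /= andbT; lra.
- have /andP[f0 f1] := f01 l x; rewrite ler_distl /h; apply/andP; split.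
    by rewrite !le_max lexx orbT.
  by rewrite !ge_max !ge_min lexx orbT andbT; apply/andP; split; lra.
- have [[b l]] := vP _ (bary z Az); rewrite !inE andbT /base' /mate' /= => bS neq.
  by exists b => //; exists l; rewrite !hE // !gE.
Qed.

(** * Coordinates and neighbourhoods in the space of maps into the cube *)

Section CubeMaps.
Variables (R : realType) (X : topologicalType) (m : nat).
Implicit Types h : cube_maps R X m.

Definition component h (l : 'I_m) (x : X) : R :=
  set_val ((h : continuousType X (cube R m)) x) ord0 l.

Lemma component_continuous h l : continuous (component h l).
Proof.
move=> x; apply: (@continuous_comp _ _ _ (h : continuousType X (cube R m))
  (fun v => set_val v ord0 l)).
  exact: cts_fun.
apply: (@continuous_comp _ _ _ (set_val : cube R m -> 'rV[R]_m) (fun v => v ord0 l)).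
  exact: initial_continuous.
exact: coord_continuous.
Qed.

Lemma component01 h l x : 0 <= component h l x <= 1.
Proof. by rewrite /component; case: (_ x) => v vC /=; have /set_mem := vC. Qed.

Lemma eq_components h h' x y :
  (h : continuousType X (cube R m)) x = (h' : continuousType X (cube R m)) y <->
  forall l, component h l x = component h' l y.
Proof.
split=> [hh' l|eqc]; first by rewrite /component hh'.
apply: val_inj; apply/rowP => l; exact: eqc.
Qed.

Lemma cube_map_of_coords (f : 'I_m -> X -> R) :
  (forall l, continuous (f l)) -> (forall l x, 0 <= f l x <= 1) ->
  exists h, forall l x, component h l x = f l x.
Proof.
move=> fc f01.
have fin x : (\row_l f l x) \in cube R m.
  by apply/mem_set => l; rewrite mxE f01.
pose F x : cube R m := exist (fun v => v \in cube R m) (\row_l f l x) (fin x).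
have Fc : continuous F.
  apply: continuous_comp_initial => x.
  apply/cvgrPdist_lt => e e0.
  have : \forall y \near x, forall l, `|f l x - f l y| < e.
    apply: filter_forall => l.
    have /(@cvgrPdist_lt _ R^o) fcl : f l y @[y --> x] --> f l x := fc l x.
    exact: fcl.
  apply: filterS => y fxy.
  rewrite /Num.norm /= mx_normrE (bigmax_lt _ _) //= => -[i l] _.
  by rewrite !mxE.
exists (mkcts Fc : continuousType X (cube R m)) => l x.
by rewrite /component /= mxE.
Qed.

Lemma nbhs_cube_maps h (U : set (cube_maps R X m)) : nbhs h U <->
  exists2 e : R, 0 < e &
    forall h', (forall l x, `|component h l x - component h' l x| < e) -> U h'.
Proof.
rewrite -nbhs_entourageE; split.
  move=> [E [E' [E'' [E3 + E3s] E''s] E's] Es].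
  rewrite -entourage_ballE => -[e /= e0 es]; exists e => // h' hh'.
  apply: Es; apply/xsectionP; apply: E's; apply: E''s => x; apply: E3s; apply: es => /=.
  rewrite /ball /= /mx_ball; split => // i l; rewrite ord1.
  exact: hh'.
move=> [e e0 eU].
exists [set hh | forall x, ball (set_val ((hh.1 : continuousType X (cube R m)) x)) e
                          (set_val ((hh.2 : continuousType X (cube R m)) x))].
  exists [set ff : (X -> cube R m) * (X -> cube R m) | forall x, ball (set_val (ff.1 x)) e
                          (set_val (ff.2 x))]; last by [].
  exists [set vv : cube R m * cube R m | ball (set_val vv.1) e (set_val vv.2)]; last by [].
  exists [set vv : 'rV[R]_m * 'rV[R]_m | ball vv.1 e vv.2]; last by [].
  by rewrite -entourage_ballE; exists e.
move=> h' /xsectionP /= hh'; apply: eU => l x.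
by have [_ /(_ ord0 l)] := hh' x.
Qed.

End CubeMaps.

(** * Collisions on a compact set of pairs *)

Lemma continuous_iter (X : topologicalType) (T : X -> X) i :
  continuous T -> continuous (iter i T).
Proof.
move=> Tc; elim: i => [|i IH] x; first exact: cvg_id.
by apply: (@continuous_comp _ _ _ (iter i T) T); [exact: IH | exact: Tc].
Qed.

Definition collisions (R : realType) (X : topologicalType) (T : X -> X) (m D : nat)
    (K : set (X * X)) : set (cube_maps R X m) :=
  [set h | exists2 p, K p & forall i l, (i <= D)%N ->
     component h l (iter i T p.1) = component h l (iter i T p.2)].

(** On a compact K, a map that separates every pair does so by a margin d, so all
    maps within d of it separate every pair too: avoiding collisions is an open
    condition, and it remains to see that it is dense. *)
Lemma nowhere_dense_collisions (R : realType) (X : topologicalType) (T : X -> X)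
    (m D : nat) (K : set (X * X)) : continuous T -> compact K ->
  (forall (h : cube_maps R X m) e, 0 < e -> exists h' : cube_maps R X m,
     (forall l x, `|component h l x - component h' l x| <= e) /\
     forall p, K p -> exists i l, (i <= D)%N /\
       component h' l (iter i T p.1) <> component h' l (iter i T p.2)) ->
  nowhere_dense (@collisions R X T m D K).
Proof.
move=> Tc Kc dense; apply/seteqP; split=> // h.
move=> /nbhs_cube_maps[e e0 hcl].
have e20 : 0 < e / 2 by rewrite divr_gt0.
have [h' [hh' avoid]] := dense h (e / 2) e20.
pose gap i l (p : X * X) := `|component h' l (iter i T p.1) - component h' l (iter i T p.2)|.
have gapc i l : continuous (gap i l).
  have cl : continuous (component h' l \o iter i T).
    by move=> y; apply: continuous_comp; [exact: continuous_iter | exact: component_continuous].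
  move=> p; apply: cvg_norm; apply: cvgB.
    by apply: (@continuous_comp _ _ _ fst (component h' l \o iter i T)); [exact: cvg_fst | exact: cl].
  by apply: (@continuous_comp _ _ _ snd (component h' l \o iter i T)); [exact: cvg_snd | exact: cl].
have : \forall d \near 0^'+, K `<=` [set p | exists i l, (i <= D)%N /\ d + d < gap i l p].
  have /compact_near_coveringP cov := Kc.
  apply: (cov _ _ (fun d p => exists i l, (i <= D)%N /\ d + d < gap i l p)).
  move=> p /avoid[i [l [iD neq]]].
  have g0 : 0 < gap i l p by rewrite normr_gt0 subr_eq0; apply/eqP.
  have near_p : \forall q \near p, gap i l p / 2 < gap i l q.
    have := gapc i l p; move=> /(@cvgrPdist_lt _ R^o).
    move=> /(_ (gap i l p / 2)); rewrite divr_gt0 // => /(_ isT).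
    by apply: filterS => q; rewrite ltr_norml => /andP[_]; lra.
  have near_0 : \forall d \near (0 : R)^'+, d < gap i l p / 4.
    by apply: nbhs_right_lt; rewrite divr_gt0.
  near=> q d => /=; exists i, l; split => //.
  have : gap i l p / 2 < gap i l q by near: q.
  have : d < gap i l p / 4 by near: d.
  by lra.
move=> h0.
have [d /= [d0 dgap]] : exists d : R, 0 < d /\
    K `<=` [set p | exists i l, (i <= D)%N /\ d + d < gap i l p].
  suff : \forall d \near (0 : R)^'+, 0 < d /\
    K `<=` [set p | exists i l, (i <= D)%N /\ d + d < gap i l p] by move=> /filter_ex.
  by near=> d; split; near: d; [exact: nbhs_right_gt | ].
have : closure (collisions T D K) h'.
  by apply: hcl => l x; apply: le_lt_trans (hh' l x) _; lra.
have /[swap] /[apply] : nbhs h' [set h'' : cube_maps R X m |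
    forall l x, `|component h' l x - component h'' l x| < d].
  by apply/nbhs_cube_maps; exists d.
move=> [h'' [[p Kp eqp] close]].
have [i [l [iD]]] := dgap p Kp; rewrite /gap.
have := close l (iter i T p.1); have := close l (iter i T p.2).
rewrite (eqp i l iD); move: (component _ _ _) (component _ _ _) (component _ _ _).
move=> u v w; rewrite !ltr_norml => /andP[? ?] /andP[? ?].
by apply/negP; rewrite -leNgt ler_norml; apply/andP; split; lra.
Unshelve. all: by end_near. Qed.

(** * Avoiding collisions of delay vectors *)

(** The set in which a point of period p is treated: the points of period at most
    p, or the whole space for the last value p = M, which stands for all the
    periods that are at least M or infinite. *)
Definition level (X : topologicalType) (T : X -> X) (M p : nat) : set X :=
  [set x | (p < M)%N -> periodic_points T p x].

Lemma iter_mod (X : Type) (T : X -> X) x p i : iter p T x = x ->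
  iter i T x = iter (i %% p) T x.
Proof.
move=> per; rewrite [in LHS](divn_eq i p) addnC iterD; congr (iter _ T _).
by elim: (i %/ p)%N => // c IH; rewrite mulSn iterD IH.
Qed.

Lemma iter_cancel (X : Type) (T g : X -> X) i : cancel T g -> cancel (iter i T) (iter i g).
Proof. by move=> Tg; elim: i => // i IH x; rewrite iterSr /= Tg IH. Qed.

Definition disjoint_iterates (X : Type) (T : X -> X) (p : nat) (A : set X) :=
  forall i j x y, (i < p)%N -> (j < p)%N -> A x -> A y ->
    iter i T x = iter j T y -> i = j.
Lemma level_iter (X : topologicalType) (T : X -> X) M p (A : set X) x i :
  (p <= M)%N -> A `<=` level T M p ->
  disjoint_iterates T p A ->
  A x -> (i < M)%N -> iter i T x = iter (i %% p) T x.
Proof.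
move=> pM AQ disj Ax iM; have [pM'|Mp] := ltnP p M; last first.
  by rewrite modn_small // (leq_trans iM).
apply: iter_mod; have [j [/andP[j0 jp] Tj]] := AQ x Ax pM'.
have [->//|/eqP jp'] := eqVneq p j.
have {}jp : (j < p)%N by lia.
have := disj j 0%N x x jp (leq_ltn_trans (leq0n _) jp) Ax Ax Tj; lia.
Qed.

Section Avoid.
Variables (R : realType) (X : metricType R) (x0 : X) (T g : X -> X) (m : nat).
Hypotheses (Tc : continuous T) (gc : continuous g) (Tg : cancel T g) (gT : cancel g T).

Lemma cube_map_perturbation
    (B N : finType) (base : N -> B) (S : {set N}) (mate : N -> N) (a : B -> nat)
    (A : B -> set X) (t : N -> nat) (h : cube_maps R X m) (e : R) :
  (forall i, closed (A i)) -> (forall i, dim_le (A i) (a i)) ->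
  (forall b b' x x', A (base b) x -> A (base b') x' ->
     iter (t b) T x = iter (t b') T x' -> b = b') ->
  (forall b, b \in S -> mate b \notin S) -> (\sum_i a i < m * #|S|)%N -> 0 < e ->
  exists h' : cube_maps R X m,
    (forall l x, `|component h l x - component h' l x| <= e) /\
    forall z, (forall i, A i (z i)) -> exists2 b, b \in S & exists l,
      component h' l (iter (t b) T (z (base b))) <>
      component h' l (iter (t (mate b)) T (z (base (mate b)))).
Proof.
move=> clA dimA disA mateS sumS e0.
have [f [fc f01 fh fz]] := @perturbation R X x0 B N base S mate a A
  (fun b => iter (t b) T) (fun b => iter (t b) g) m (component h) e
  (fun b => @continuous_iter _ T (t b) Tc) (fun b => @continuous_iter _ g (t b) gc)
  (fun b => @iter_cancel _ T g (t b) Tg) (fun b => @iter_cancel _ g T (t b) gT)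
  clA dimA disA mateS sumS (@component_continuous _ _ _ h) (@component01 _ _ _ h) e0.
have [h' h'f] := cube_map_of_coords fc f01.
exists h'; split => [l x|z Az]; first by rewrite h'f distrC.
have [b bS [l fneq]] := fz z Az; exists b => //; exists l.
by rewrite !h'f; apply/eqP.
Qed.

(** The nodes are the first p iterates of A and the first q iterates of B. Since
    p <= q, the q equations h (T ^ j x) = h (T ^ j y) have distinct right-hand
    nodes, all different from the left-hand ones: m * q equations against a + b
    parameters. *)
Lemma avoid_distinct_orbits (D p q a b : nat) (A B : set X)
    (h : cube_maps R X m) (e : R) :
  (0 < p)%N -> (p <= q)%N -> (q <= D.+1)%N -> closed A -> closed B ->
  dim_le A a -> dim_le B b -> (2 * a < m * p)%N -> (2 * b < m * q)%N ->
  A `<=` level T D.+1 p ->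
  disjoint_iterates T p A ->
  disjoint_iterates T q B ->
  (forall i j x y, (i < p)%N -> (j < q)%N -> A x -> B y ->
     iter i T x <> iter j T y) -> 0 < e ->
  exists h' : cube_maps R X m,
    (forall l x, `|component h l x - component h' l x| <= e) /\
    forall x y, A x -> B y -> exists i l, (i <= D)%N /\
      component h' l (iter i T x) <> component h' l (iter i T y).
Proof.
move=> p0 pq qD clA clB dA dB ap bq AQ disA disB disAB e0.
pose N := ('I_p + 'I_q)%type.
pose base (s : N) := if s is inl _ then true else false.
pose t (s : N) : nat := match s with inl i => i | inr j => j end.
pose mate (s : N) : N := match s with inl i => inl i
  | inr j => inl (Ordinal (ltn_pmod j p0)) end.
pose S : {set N} := [set inr j | j : 'I_q]%SET.
have inS s : (s \in S) = ~~ base s.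
  by case: s => [i|j] /=; [apply/imsetP => -[] | apply/imsetP; exists j].
pose Z (c : bool) := if c then A else B.
have [] := @cube_map_perturbation _ _ base S mate (fun c => if c then a else b)
  Z t h e.
- by case.
- by case.
- move=> [i|i] [j|j] x y /= Zx Zy eqT.
  + by congr inl; apply/val_inj/(disA _ _ _ _ _ _ Zx Zy eqT).
  + by case: (disAB _ _ _ _ _ _ Zx Zy eqT).
  + by case: (disAB _ _ _ _ _ _ Zy Zx (esym eqT)).
  + by congr inr; apply/val_inj/(disB _ _ _ _ _ _ Zx Zy eqT).
- by move=> s; rewrite !inS; case: s.
- have inr_inj : injective (@inr 'I_p 'I_q) by move=> ? ? [].
  by rewrite big_bool /= card_imset // card_ord; nia.
- exact: e0.
move=> h' [hh' av]; exists h'; split=> // x y Ax By.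
have [c|s] := av (fun c => if c then x else y); first by case: c.
rewrite inS; case: s => // j _ [l] /=.
have jD : (j < D.+1)%N by apply: leq_trans qD.
rewrite -(level_iter (leq_trans pq qD) AQ disA Ax jD) => neq.
by exists j, l; split => //; exact: nesym.
Qed.

(** The nodes are the p iterates of A, and the equations h (T ^ i x) = h (T ^ (i + k) x)
    for i <= D are the edges of a graph on them. None of the minn p D.+1 nodes
    b <= D is isolated, so half of them can be taken as S by half_matching, and a
    single point only brings a parameters. The level goes up to 2 * D because
    i + k does. *)
Lemma avoid_same_orbit (D p k a : nat) (A : set X) (h : cube_maps R X m) (e : R) :
  (0 < k)%N -> (k < p)%N -> (k <= D)%N -> (p <= (2 * D).+1)%N -> closed A ->
  dim_le A a -> (2 * a < m * minn p D.+1)%N ->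
  A `<=` level T (2 * D).+1 p ->
  disjoint_iterates T p A -> 0 < e ->
  exists h' : cube_maps R X m,
    (forall l x, `|component h l x - component h' l x| <= e) /\
    forall x, A x -> exists i l, (i <= D)%N /\
      component h' l (iter i T x) <> component h' l (iter i T (iter k T x)).
Proof.
move=> k0 kp kD pD clA dA ap AQ disA e0.
have p0 : (0 < p)%N by apply: leq_ltn_trans kp.
pose adj (b c : 'I_p) := (b <= D)%N && (c == (b + k) %% p :> nat)%N.
pose edge b c := adj b c || adj c b.
have edgeC : symmetric edge by move=> b c; rewrite /edge orbC.
have adjI b : adj b b = false.
  apply/negP => /andP[_ /eqP]; have bp := ltn_ord b; have [bk|bk] := ltnP (b + k)%N p.
    by rewrite modn_small //; lia.
  rewrite -(subnK bk) modnDr modn_small; lia.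
have edgeI : irreflexive edge by move=> b; rewrite /edge adjI.
pose V := [set b : 'I_p | (b <= D)%N]%SET.
have cardV : #|V| = minn p D.+1.
  have := card_ord (minn p D.+1); rewrite -{1}cardsT => <-.
  have le : (minn p D.+1 <= p)%N by rewrite geq_minl.
  have winj : injective (widen_ord le) by move=> b c /(congr1 val) /= /val_inj.
  rewrite -(card_imset _ winj); apply: eq_card => b; rewrite !inE.
  apply/idP/imsetP => [bD|[c _ ->]] /=.
    have lt : (b < minn p D.+1)%N by rewrite leq_min ltn_ord ltnS.
    by exists (Ordinal lt) => //; exact: val_inj.
  by have := ltn_ord c; rewrite leq_min => /andP[].
have nb b : b \in V -> exists c, edge b c.
  rewrite inE => bD; exists (Ordinal (ltn_pmod (b + k) p0)).
  by rewrite /edge /adj bD eqxx.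
have [S [SV VS SP]] := half_matching edgeC edgeI nb.
have /fin_all_exists[mate mateP] b : exists c, b \in S -> edge b c /\ c \notin S.
  have [bS|_] := boolP (b \in S); last by exists b.
  by have [c] := SP b bS; exists c.
have [] := @cube_map_perturbation unit _ (fun=> tt) S mate (fun=> a) (fun=> A)
  (fun b : 'I_p => b) h e.
- by [].
- by [].
- by move=> b c x y Ax Ay eqT; apply/val_inj/(disA _ _ _ _ _ _ Ax Ay eqT).
- by move=> b /mateP[].
- rewrite big_const card_unit /= addn0 -(ltn_pmul2l (ltn0Sn 1)).
  by rewrite (leq_trans ap) // -cardV mulnCA leq_mul2l VS orbT.
- exact: e0.
move=> h' [hh' av]; exists h'; split=> // x Ax.
have [//|b /mateP[eb _] [l] /=] := av (fun=> x).
have shift (c : 'I_p) : (c <= D)%N -> iter ((c + k) %% p) T x = iter c T (iter k T x).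
  by move=> cD; rewrite -iterD; apply/esym/(level_iter pD AQ disA Ax); lia.
case/orP: eb => /andP[bD /eqP ->] neq.
  by exists b, l; split => //; rewrite -shift.
by exists (mate b), l; split => //; rewrite -shift //; exact: nesym.
Qed.

End Avoid.

(** * Periods, levels and their dimensions *)

Lemma separate_iterates (R : realType) (X : metricType R) (T : X -> X)
    (r : nat -> nat -> Prop) p q x y : continuous T ->
  (forall i j, (i < p)%N -> (j < q)%N -> r i j -> iter i T x <> iter j T y) ->
  exists W W' : set X, [/\ nbhs x W, nbhs y W' & forall i j x' y',
    (i < p)%N -> (j < q)%N -> r i j -> W x' -> W' y' -> iter i T x' <> iter j T y'].
Proof.
move=> Tc neq.
pose off (ij : 'I_p * 'I_q) (z : X * X) :=
  r ij.1 ij.2 -> iter ij.1 T z.1 <> iter ij.2 T z.2.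
have : filter_prod (nbhs x) (nbhs y) [set z | forall ij, off ij z].
  apply: (@filter_forall _ _ off _ (filter_prod_filter _ _)) => -[i j]; rewrite /off /=.
  have [rij|nr] := pselect (r i j); last by exists (setT, setT) => //=; split; exact: filterT.
  have /eqP neqij := neq i j (ltn_ord i) (ltn_ord j) rij.
  have := @metric_hausdorff R X; rewrite open_hausdorff => /(_ _ _ neqij).
  move=> [[U V] /= [/set_mem Ux /set_mem Vy] [oU oV /eqP UV]].
  exists (iter i T @^-1` U, iter j T @^-1` V) => /=.
    split; [apply: (continuous_iter Tc)|apply: (continuous_iter Tc)];
      exact: open_nbhs_nbhs.
  move=> [x' y'] [/= Ux' Vy'] _ eqxy; have : (U `&` V) (iter i T x').
    by split => //; rewrite eqxy.
  by rewrite UV.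
move=> [[W W'] /= [xW yW'] sub]; exists W, W'; split => // i j x' y' ip jq rij Wx Wy.
exact: (sub (x', y') (conj Wx Wy) (Ordinal ip, Ordinal jq)).
Unshelve. all: by end_near. Qed.

Lemma disjoint_iterates_near (R : realType) (X : metricType R) (T : X -> X) p x :
  continuous T -> disjoint_iterates T p [set x] ->
  exists2 W, nbhs x W & disjoint_iterates T p W.
Proof.
move=> Tc dis; have [|W [W' [xW xW' sep]]] :=
    @separate_iterates R X T (fun i j => i <> j) p p x x Tc.
  by move=> i j ip jp ij eqT; apply/ij/(dis i j x x).
exists (W `&` W'); first exact: filterI.
move=> i j y z ip jp [Wy _] [_ Wz] eqT.
by apply: contrapT => ij; apply: (sep i j y z).
Qed.

Lemma disjoint_iteratesS (X : Type) (T : X -> X) p (A B : set X) :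
  A `<=` B -> disjoint_iterates T p B -> disjoint_iterates T p A.
Proof. by move=> AB dis i j x y ip jp /AB Bx /AB By; exact: dis. Qed.

Lemma closed_level (R : realType) (X : metricType R) (T : X -> X) M p :
  continuous T -> closed (level T M p).
Proof.
move=> Tc; have [pM|Mp] := boolP (p < M)%N; last first.
  have -> : level T M p = setT by apply/seteqP; split=> // x _ pM; case/negP: Mp.
  exact: closedT.
have -> : level T M p = periodic_points T p.
  by apply/seteqP; split=> x /=; [apply | move=> ? _].
rewrite -openC openE => x /= nper.
have [|W [W' [xW xW' dis]]] :=
    @separate_iterates R X T (fun i j => (0 < i)%N) p.+1 1 x x Tc.
  move=> i [|//] ip _ i0 Ti; apply: nper; exists i; split => //.
  by rewrite i0 -ltnS.
apply: (@filterS _ _ _ (W `&` W')); last exact: filterI.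
move=> z [Wz Wz'] [i [/andP[i0 ip] Ti]].
by apply: (dis i 0%N z z).
Qed.

(** The least period of x, cut off at M. *)
Lemma exists_level (X : topologicalType) (T g : X -> X) M x : cancel T g -> (0 < M)%N ->
  exists p, [/\ (0 < p <= M)%N, level T M p x &
    disjoint_iterates T p [set x]].
Proof.
move=> Tg M0.
have back i j : (i <= j)%N -> iter i T x = iter j T x -> iter (j - i) T x = x.
  move=> ij; rewrite -{1}(subnKC ij) iterD => eqT.
  by apply: (can_inj (@iter_cancel _ T g i Tg)); rewrite -eqT.
have dist p : (forall i, (0 < i < p)%N -> iter i T x <> x) ->
    disjoint_iterates T p [set x].
  move=> np i j _ _ ip jp -> ->.
  wlog ij : i j ip jp / (i < j)%N => [H eqT|].
    have [ij|ji|//] := ltngtP i j; first exact: H.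
    by apply/esym/H.
  by move=> /(back _ _ (ltnW ij)) eqT; case: (np (j - i)%N) => //; lia.
have [ex|none] := pselect (exists i, `[< (0 < i < M)%N /\ iter i T x = x >]).
  have [p /asboolP[/andP[p0 pM] Tp] minp] := ex_minnP ex.
  exists p; split; [by rewrite p0 ltnW | by move=> _; exists p; rewrite p0 leqnn |].
  apply: dist => i /andP[i0 ip] Ti; suff : (p <= i)%N by lia.
  by apply/minp/asboolP; split => //; lia.
exists M; split; [by rewrite M0 leqnn | by rewrite /level /= ltnn |].
by apply: dist => i iM Ti; apply: none; exists i; apply/asboolP.
Qed.

(** Up to period 2 * d the hypothesis on periodic points gives the bound, a being
    the greatest integer below m * p / 2; beyond, d does since m >= 1. *)
Lemma dim_le_level (R : realType) (X : metricType R) (x0 : X) (T : X -> X) (d m M p : nat) :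
  continuous T -> compact [set: X] -> covering_dim X R = d%:R%:E ->
  (forall n : nat, (1 <= n <= 2 * d)%N ->
      (covering_dim (periodic_points T n) R < ((m * n)%:R / 2)%:E)%E) ->
  (0 < m)%N -> (0 < p)%N -> (2 * d < M)%N ->
  exists2 a, dim_le (level T M p) a & (2 * a < m * minn p (2 * d).+1)%N.
Proof.
move=> Tc compX dimX dimP m0 p0 dM.
have [pd|dp] := leqP p (2 * d).
  exists ((m * p).-1 %/ 2)%N; last first.
    have := leq_trunc_div (m * p).-1 2; rewrite (minn_idPl _) ?(leq_trans pd) //; nia.
  have levE : level T M p = range (set_val : periodic_points T p -> X).
    apply/seteqP; split => [x /= /(_ (leq_ltn_trans pd dM)) Px|_ [[x /= /set_mem Px] _ <-] _ //].
    by exists (exist (fun x => x \in periodic_points T p) x (mem_set Px)).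
  have dimPp := dimP p; rewrite p0 pd in dimPp.
  rewrite levE; apply: (dim_le_covering x0 _ _ compX _ (dimPp isT)).
  - exact: initial_continuous.
  - by move=> V [W oW <-]; exists W.
  - by rewrite -levE; exact: closed_level.
  move=> k; rewrite ltr_pdivlMr // => lek.
  have : (k * 2 < (m * p)%:Z) by rewrite -(ltr_int R) rmorphM.
  case: k {lek} => [k|k] //.
  by rewrite -PoszM ltz_nat lez_nat leq_divRL //; lia.
exists d; last by rewrite (minn_idPr _) //; nia.
apply: (@dim_leS _ _ _ (range (@id X))); first by move=> x _; exists x.
apply: (@dim_le_covering R X X id (d.+1)%:R d x0 _ _ compX).
- by move=> x; exact: cvg_id.
- by move=> V oV; exists V.
- by rewrite image_id; exact: closedT.
- by rewrite dimX lte_fin ltr_nat.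
- move=> k; rewrite -[_%:R]/(d.+1%:Z%:~R) ltr_int; lia.
Qed.

(** Closed balls of radii 1 / n.+1 around the points of finite nets. *)
Lemma closed_network (R : realType) (X : metricType R) (x0 : X) : compact [set: X] ->
  exists A : nat * nat -> set X, (forall t, closed (A t)) /\
    forall x W, nbhs x W -> exists2 t, A t x & A t `<=` W.
Proof.
move=> compX.
have /choice[s sP] (n : nat) : exists s : seq X,
    forall y, setT y -> exists2 c, c \in s & ball c n.+1%:R^-1 y.
  apply: compact_subcover => // c; apply: nbhsx_ballx.
  by rewrite invr_gt0.
exists (fun t => closure (ball (nth x0 (s t.1) t.2) t.1.+1%:R^-1)); split.
  by move=> t; exact: closed_closure.
move=> x W /nbhs_ballP[e /= e0 eW].
have [n ne] : exists n : nat, n.+1%:R^-1 < e / 3.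
  have e30 : 0 < e / 3 by rewrite divr_gt0.
  have [n] := @ltr_add_invr R 0 (e / 3) e30; rewrite add0r; by exists n.
have [c cs cx] := sP n x I.
exists (n, index c (s n)); rewrite /= nth_index //; first exact: subset_closure.
move=> y cy; apply: eW.
have [z [cz /= yz]] := cy _ (nbhsx_ballx y _ (divr_gt0 e0 (ltr0n R 3))).
have -> : e = e / 3 + e / 3 + e / 3 by field.
apply: ball_triangle (ball_sym yz); apply: (@ball_triangle _ _ c).
  by apply: (le_ball (ltW ne)); exact: ball_sym.
by apply: (le_ball (ltW ne)).
Qed.

Lemma continuous_delay_map (R : realType) (X : topologicalType) (T : X -> X) m N
    (h : cube_maps R X m) : continuous T -> continuous (delay_map T h N).
Proof.
move=> Tc x; apply/cvg_sup => i.
apply: (@continuous_comp_initial _ _ _ (fun f : 'I_N.+1 -> cube R m => f i)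
  (delay_map T h N)) => y.
apply: (@continuous_comp _ _ _ (iter i T) (h : continuousType X (cube R m))).
  exact: continuous_iter.
exact: cts_fun.
Qed.

(** * The countable family of pieces *)

Lemma nowhere_denseS (S : topologicalType) (A B : set S) :
  A `<=` B -> nowhere_dense B -> nowhere_dense A.
Proof.
move=> AB nB; apply/seteqP; split=> // x xA; rewrite -[set0]nB.
by move: xA; apply: interiorS; exact: closure_subset.
Qed.

Lemma comeagre_countable (S : topologicalType) (I : countType) (A : set S)
    (F : I -> set S) :
  (forall i, nowhere_dense (F i)) -> A = ~` (\bigcup_i F i) -> comeagre A.
Proof.
move=> ndF ->; exists (fun n => if choice.unpickle n is Some i then F i else set0).
  move=> n; case: choice.unpickle => [i|]; first exact: ndF.
  by rewrite /nowhere_dense closure0 interior0.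
congr (~` _); apply/seteqP; split=> [h [i _ Fi]|h [n _]].
  by exists (choice.pickle i) => //; rewrite choice.pickleK.
by case: choice.unpickle => // i Fi; exists i.
Qed.

Section Pieces.
Variables (R : realType) (X : metricType R) (T g : X -> X) (d m : nat) (x0 : X).
Hypotheses (m_gt0 : (0 < m)%N) (compX : compact [set: X]).
Hypotheses (Tc : continuous T) (gc : continuous g) (Tg : cancel T g) (gT : cancel g T).
Hypothesis dimX : covering_dim X R = d%:R%:E.
Hypothesis dimP : forall n : nat, (1 <= n <= 2 * d)%N ->
  (covering_dim (periodic_points T n) R < ((m * n)%:R / 2)%:E)%E.
Variable A : nat * nat -> set X.
Hypotheses (clA : forall t, closed (A t)).
Hypothesis netA : forall x W, nbhs x W -> exists2 t, A t x & A t `<=` W.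

(** Countably many compact sets of pairs. In the first kind q is not a period but
    the exponent k of pairs (x, T ^ k x); the levels go up to 4 * d + 1 there, since
    the iterates of x met by the two delay vectors go up to 4 * d, and up to
    2 * d + 1 for the pairs of the second kind. *)
Definition piece (t : bool * (nat * nat) * ((nat * nat) * (nat * nat))) : set (X * X) :=
  let: (same, (p, q), (u, v)) := t in
  if same then (fun x => (x, iter q T x)) @` (A u `&` level T (2 * (2 * d)).+1 p)
  else (A u `&` level T (2 * d).+1 p) `*` (A v `&` level T (2 * d).+1 q).

(** Collisions are symmetric in the pair, hence the two orders. *)
Definition covered x y := exists2 t, piece t (x, y) \/ piece t (y, x) &
  nowhere_dense (@collisions R X T m (2 * d) (piece t)).

Lemma coveredC x y : covered x y -> covered y x.
Proof. by move=> [t xy nd]; exists t => //; case: xy; [right | left]. Qed.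

Lemma compact_piece t : compact (piece t).
Proof.
have cAl u M p : compact (A u `&` level T M p).
  apply: (subclosed_compact _ compX) => //.
  by apply: closedI; [exact: clA | exact: closed_level].
case: t => -[[] [p q]] [u v] /=; last exact: compact_setX.
apply: continuous_compact => //; apply: continuous_subspaceT => x.
by apply: cvg_pair; [exact: cvg_id | exact: continuous_iter].
Qed.

Lemma covered_distinct_orbits x y :
  (forall i j, (i <= 2 * d)%N -> (j <= 2 * d)%N -> iter i T x <> iter j T y) ->
  covered x y.
Proof.
move=> dis.
have [p [/andP[p0 pD] px px']] := @exists_level _ T g (2 * d).+1 x Tg (ltn0Sn _).
have [q [/andP[q0 qD] qy qy']] := @exists_level _ T g (2 * d).+1 y Tg (ltn0Sn _).
wlog pq : x y p q p0 pD px px' q0 qD qy qy' dis / (p <= q)%N.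
  move=> H; have [pq|/ltnW qp] := leqP p q; first exact: (H x y p q).
  by apply/coveredC/(H y x q p) => // i j iD jD /esym; exact: dis.
have [Wx nWx disx] := disjoint_iterates_near Tc px'.
have [Wy nWy disy] := disjoint_iterates_near Tc qy'.
have [|W [W' [nW nW' sep]]] :=
    @separate_iterates R X T (fun _ _ => True) p q x y Tc.
  by move=> i j ip jq _; apply: dis; rewrite -ltnS; [exact: leq_trans pD | exact: leq_trans qD].
have [u ux uW] := netA (filterI nW nWx).
have [v vy vW] := netA (filterI nW' nWy).
exists (false, (p, q), (u, v)); first by left.
apply: nowhere_dense_collisions => //; first exact: compact_piece.
move=> h e e0.
have [a da ap] := @dim_le_level R X x0 T d m (2 * d).+1 p Tc compX dimX dimP m_gt0 p0 (ltnSn _).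
have [b db bq] := @dim_le_level R X x0 T d m (2 * d).+1 q Tc compX dimX dimP m_gt0 q0 (ltnSn _).
rewrite (minn_idPl pD) in ap; rewrite (minn_idPl qD) in bq.
have [] := @avoid_distinct_orbits R X x0 T g m Tc gc Tg gT (2 * d) p q a b
  (A u `&` level T (2 * d).+1 p) (A v `&` level T (2 * d).+1 q) h e p0 pq qD _ _
  (dim_leS (@subIsetr _ _ _) da) (dim_leS (@subIsetr _ _ _) db) ap bq (@subIsetr _ _ _).
- by apply: closedI; [exact: clA | exact: closed_level].
- by apply: closedI; [exact: clA | exact: closed_level].
- by apply: disjoint_iteratesS disx => z [/uW[]].
- by apply: disjoint_iteratesS disy => z [/vW[]].
- move=> i j x1 x2 ip jp [/uW[W1 _] _] [/vW[W2 _] _].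
  exact: (sep i j x1 x2).
- exact: e0.
move=> h' [hh' av]; exists h'; split=> // -[x1 y1] [/= xA yA]; exact: av.
Qed.

Lemma covered_same_orbit x k : (k <= 2 * d)%N -> x <> iter k T x ->
  covered x (iter k T x).
Proof.
move=> kD xk; set D := (2 * d)%N in kD *.
have [p [/andP[p0 pD] px px']] := @exists_level _ T g (2 * D).+1 x Tg (ltn0Sn _).
have kE : iter k T x = iter (k %% p) T x.
  by apply: (@level_iter _ T _ p [set x] x k pD) => //; [move=> _ -> | lia].
have kp : (k %% p < p)%N by rewrite ltn_pmod.
have k'D : (k %% p <= D)%N by apply: leq_trans kD; exact: leq_mod.
have k0 : (0 < k %% p)%N.
  by rewrite lt0n; apply/eqP => k0; apply: xk; rewrite kE k0.
rewrite kE; move: kp k'D k0; move: (k %% p)%N => c cp cD c0.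
have [Wx nWx disx] := disjoint_iterates_near Tc px'.
have [u ux uW] := netA nWx.
exists (true, (p, c), (u, u)); first by left; exists x.
apply: nowhere_dense_collisions => //; first exact: compact_piece.
move=> h e e0.
have DM : (2 * d < (2 * D).+1)%N by rewrite /D; lia.
have [a da ap] := @dim_le_level R X x0 T d m (2 * D).+1 p Tc compX dimX dimP m_gt0 p0 DM.
have [] := @avoid_same_orbit R X x0 T g m Tc gc Tg gT D p c a
  (A u `&` level T (2 * D).+1 p) h e c0 cp cD pD _
  (dim_leS (@subIsetr _ _ _) da) ap (@subIsetr _ _ _).
- by apply: closedI; [exact: clA | exact: closed_level].
- by apply: disjoint_iteratesS disx => z [/uW].
- exact: e0.
move=> h' [hh' av]; exists h'; split=> // _ [x1 xA <-]; exact: av.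
Qed.

Lemma covered_neq x y : x <> y -> covered x y.
Proof.
move=> xy.
have [[[i j] /= [iD jD eqT]]|none] := pselect (exists ij : nat * nat,
    [/\ (ij.1 <= 2 * d)%N, (ij.2 <= 2 * d)%N & iter ij.1 T x = iter ij.2 T y]); last first.
  by apply: covered_distinct_orbits => i j iD jD eqT; apply: none; exists (i, j).
wlog ji : x y xy i j iD jD eqT / (j <= i)%N.
  move=> H; have [ji|/ltnW ij] := leqP j i; first exact: (H x y xy i j).
  by apply/coveredC/(H y x (nesym xy) j i).
have yE : y = iter (i - j) T x.
  apply: (can_inj (@iter_cancel _ T g j Tg)).
  by rewrite -eqT -iterD subnKC.
rewrite yE; apply: covered_same_orbit; last by rewrite -yE.
by apply: leq_trans iD; exact: leq_subr.
Qed.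

End Pieces.

Theorem theorem1 (R : realType) (X : metricType R) (T : X -> X) (d m : nat)
    (m_gt0 : (0 < m)%N)
    (compactX : compact [set: X])
    (homeoT : homeomorphism T)
    (dimX : covering_dim X R = d%:R%:E)
    (dimP : forall n : nat, (1 <= n <= 2 * d)%N ->
      (covering_dim (periodic_points T n) R < ((m * n)%:R / 2)%:E)%E) :
  comeagre [set h : cube_maps R X m | embedding (delay_map T h (2 * d))].
Proof.
have [Tc [g [Tg gT gc]]] := homeoT.
have emb h : embedding (delay_map T h (2 * d)) <-> injective (delay_map T h (2 * d)).
  by split=> [[]//|inj]; split=> //; exact: continuous_delay_map.
have [[x0 _]|X0] := pselect ([set: X] !=set0); last first.
  apply: (@comeagre_countable _ nat _ (fun=> set0)).
    by move=> _; rewrite /nowhere_dense closure0 interior0.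
  apply/seteqP; split=> [h _ [] //|h _ /=]; apply/emb => x.
  by case: X0; exists x.
have [A [clA netA]] := closed_network x0 compactX.
pose bad : set (cube_maps R X m) := [set h | ~ embedding (delay_map T h (2 * d))].
pose coll t := collisions T (2 * d) (piece T d A t) `&` bad.
(* the pieces met by a collision that are not under control contribute nothing *)
pose F t := if `[< nowhere_dense (coll t) >] then coll t else set0.
apply: (@comeagre_countable _ _ _ F).
  move=> t; rewrite /F; case: asboolP => //.
  by rewrite /nowhere_dense closure0 interior0.
apply/seteqP; split=> [h good [t _]|h nF].
  by rewrite /F; case: asboolP => // _ [_ /(_ good)].
apply: contrapT => nemb; apply: nF.
have [x [y [xy eqh]]] : exists x y, x <> y /\
    delay_map T h (2 * d) x = delay_map T h (2 * d) y.
  apply: contrapT => none; apply: nemb; apply/emb => x y eqh.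
  by apply: contrapT => xy; apply: none; exists x, y.
have eqc i l : (i <= 2 * d)%N -> component h l (iter i T x) = component h l (iter i T y).
  rewrite -ltnS => iD.
  have /eq_components : (h : continuousType X (cube R m)) (iter i T x) =
    (h : continuousType X (cube R m)) (iter i T y).
    exact: (congr1 (fun f => f (Ordinal iD)) eqh).
  exact.
have [t pt nd] := covered_neq x0 m_gt0 compactX Tc gc Tg gT dimX dimP clA netA xy.
have ndt : nowhere_dense (coll t) by apply: nowhere_denseS nd; exact: subIsetl.
exists t => //; rewrite /F; case: asboolP => // _; split => //.
case: pt => pt; first by exists (x, y).
by exists (y, x) => // i l iD /=; rewrite eqc.
Qed.
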